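(* Let $d\ge 1$ be an integer. For every positive integer $k<d+1$, there does not exist a $k$-list replicable algorithm for the $d$-Coin Bias Estimation Problem.
   Context: Notation: for $\vec p\in\mathbb{R}^d$ and $\epsilon>0$, $\overline{B}_{\epsilon}^{\infty}(\vec p)=\prod_{i=1}^d[p_i-\epsilon,p_i+\epsilon]$ is the closed $\ell_\infty$-ball. $d$-Coin Bias Estimation Problem: design a (possibly randomized) algorithm $A$ that, given $\varepsilon\in(0,\infty)$, $\delta\in(0,1]$, and $n$ independent tosses of each coin in an ordered collection of $d$ independent biased coins with (unknown) bias vector $\vec b\in[0,1]^d$ (coin $i$ shows $1$ with probability $b_i$), outputs a vector $\vec v$ such that $\|\vec b-\vec v\|_\infty\le\varepsilon$ with probability at least $1-\delta$. Here $n=n(d,\varepsilon,\delta)$ is the number of tosses per coin used by the algorithm; it does not depend on the unknown $\vec b$. $k$-list replicable: an algorithm $A$ for this problem is $k$-list replicable if for all parameters $\varepsilon\in(0,\infty)$, $\delta\in(0,1]$ there is an integer $n$ such that for every bias vector $\vec b\in[0,1]^d$ there is a set $L\subseteq\overline{B}_{\varepsilon}^{\infty}(\vec b)$ with $|L|\le k$ such that $A$, on input $\varepsilon$, $\delta$ and $n$ independent tosses per coin according to $\vec b$, outputs an estimate $\vec v\in L$ with probability at least $1-\delta$ (over the tosses and the internal randomness of $A$). A randomized algorithm may be regarded as an arbitrary randomized function of its inputs and the tosses. *)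

(* Defs.v *)
From HB Require Import structures.
From mathcomp Require Import all_boot all_order all_algebra.
From mathcomp Require Import all_classical all_reals all_analysis.

Set Implicit Arguments.
Unset Strict Implicit.
Unset Printing Implicit Defensive.

Import Order.TTheory GRing.Theory Num.Theory.

Local Open Scope classical_set_scope.
Local Open Scope ring_scope.

Definition closed_box (R : realType) (d : nat) (p : 'rV[R]_d) (eps : R) :
    set 'rV[R]_d :=
  [set v | forall i : 'I_d, p 0 i - eps <= v 0 i <= p 0 i + eps].

Definition bias_vector (R : realType) (d : nat) (b : 'rV[R]_d) : Prop :=
  forall i : 'I_d, 0 <= b 0 i <= 1.

(* [x i j] is the [j]-th toss of coin [i]; all the tosses are independent. *)
Definition toss_pmf (R : realType) (d n : nat) (b : 'rV[R]_d)
    (x : 'M[bool]_(d, n)) : R :=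
  \prod_(i < d) \prod_(j < n) bernoulli_pmf (b 0 i) (x i j).

Lemma toss_pmf_ge0 (R : realType) (d n : nat) (b : 'rV[R]_d)
    (x : 'M[bool]_(d, n)) : bias_vector b -> 0 <= toss_pmf b x.
Proof.
move=> hb; apply: prodr_ge0 => i _; apply: prodr_ge0 => j _.
exact: bernoulli_pmf_ge0.
Qed.

Lemma toss_pmf_sum1 (R : realType) (d n : nat) (b : 'rV[R]_d) :
  \sum_(x : 'M[bool]_(d, n)) toss_pmf b x = 1.
Proof.
pose F (p : 'I_d * 'I_n) (c : bool) : R := bernoulli_pmf (b 0 p.1) c.
transitivity (\sum_(f : {ffun 'I_d * 'I_n -> bool}) \prod_p F p (f p)).
  rewrite (reindex (fun f : {ffun 'I_d * 'I_n -> bool} =>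
    \matrix_(i, j) f (i, j))) /=.
    apply: eq_bigr => f _; rewrite /toss_pmf pair_big /=.
    by apply: eq_bigr => -[i j] _; rewrite mxE.
  exists (fun x : 'M[bool]_(d, n) => [ffun p => x p.1 p.2]) => x _.
    by apply/ffunP => -[i j]; rewrite ffunE mxE.
  by apply/matrixP => i j; rewrite mxE ffunE.
rewrite -(bigA_distr_bigA F) big1 // => p _.
by rewrite big_bool /F /bernoulli_pmf /= addrC subrK.
Qed.

(* [run eps delta n x] is the output on parameters [eps], [delta] and toss
   outcomes [x], as a function of the internal randomness, which is drawn from
   an arbitrary probability space. Coordinatewise measurability says that the
   output is a Borel random vector. *)
Record coin_algorithm (R : realType) (d : nat) := CoinAlgorithm {
  seed_display : measure_display;
  seed : measurableType seed_display;
  seed_law : probability seed R;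
  run : R -> R -> forall n : nat, 'M[bool]_(d, n) -> seed -> 'rV[R]_d;
  run_measurable : forall (eps delta : R) (n : nat) (x : 'M[bool]_(d, n))
    (i : 'I_d),
    measurable_fun [set: seed] (fun w => run eps delta x w 0 i) }.

Arguments seed_law {R d} c.
Arguments run {R d} c eps delta {n} x w.

(* The internal randomness is independent of the tosses, so the joint law is the
   product of [toss_pmf b] and [seed_law A]; as the tosses take finitely many
   values, its value on an event is a finite sum over the toss outcomes. *)
Definition output_prob (R : realType) (d : nat) (A : coin_algorithm R d)
    (eps delta : R) (n : nat) (b : 'rV[R]_d) (L : set 'rV[R]_d) : \bar R :=
  (\sum_(x : 'M[bool]_(d, n))
    (toss_pmf b x)%:E *
    seed_law A (run A eps delta x @^-1` L))%E.

(* Since [L] lies in the box around [b], this includes the correctness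
   requirement of the estimation problem. *)
Definition list_replicable (R : realType) (d k : nat)
    (A : coin_algorithm R d) : Prop :=
  forall eps delta : R, 0 < eps -> 0 < delta <= 1 ->
  exists n : nat, forall b : 'rV[R]_d, bias_vector b ->
  exists L : set 'rV[R]_d,
    [/\ L `<=` closed_box b eps, (L #<= `I_k)%card
      & ((1 - delta)%:E <= output_prob A eps delta n b L)%E].

(* Main.v *)
Require Import Defs.
From mathcomp Require Import all_boot all_order all_algebra.
From mathcomp Require Import all_classical all_reals all_analysis.
From mathcomp Require Import all_fingroup finmap zify ring lra.

(* Take eps = 1/4 and delta = 1 / (2 (d + 1)).  For every bias b some output v(b) in the
   list of b has probability at least (1 - delta) / k >= (1 - delta) / d.  Label a fine
   grid of the cube by v: as |v(b) - b| <= 1/4, no label occurs on two opposite faces, so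
   the Sperner-Kuhn lemma gives d + 1 grid points of one cell with distinct labels.  For
   n tosses the probability of an output is Lipschitz in b, uniformly in the output, so at
   one of these points d + 1 distinct outputs have total probability close to
   (d + 1) (1 - delta) / d > 1, a contradiction.

   The Sperner-Kuhn lemma counts fully coloured simplices modulo 2 in the Freudenthal
   triangulation.  Whether a simplex is fully coloured is the determinant over F_2 of its
   incidence matrix between vertices and colours. *)

Set Implicit Arguments.
Unset Strict Implicit.
Unset Printing Implicit Defensive.

Import Order.TTheory GRing.Theory Num.Theory.

Local Open Scope classical_set_scope.
Local Open Scope ring_scope.

(** * Fully coloured simplices as determinants over F_2 *)

Lemma F2_addrr (a : 'F_2) : a + a = 0.
Proof. exact: (addrr_pchar2 (pchar_Fp (isT : prime 2))). Qed.

Lemma F2_signr (k : nat) : (-1) ^+ k = 1 :> 'F_2.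
Proof. by rewrite (_ : -1 = 1) ?expr1n //; apply/eqP. Qed.

Section ColorMatrix.
Variables (T : Type) (c : T -> nat).

(** A colour above [d] gives a zero row, so the determinant is 1 exactly when [x 0], ..., [x d] take
    each of the colours [0], ..., [d] once. *)
Definition color_mx d (x : nat -> T) : 'M['F_2]_d.+1 :=
  \matrix_(j, i) (c (x j) == i)%:R.

Lemma eq_color_mx d (x y : nat -> T) :
  (forall j, (j <= d)%N -> x j = y j) -> color_mx d x = color_mx d y.
Proof.
by move=> exy; apply/matrixP => j i; rewrite !mxE exy // -ltnS.
Qed.

Lemma det_color_mx_missing d (x : nat -> T) (i : 'I_d.+1) :
  (forall j, (j <= d)%N -> c (x j) != i) -> \det (color_mx d x) = 0.
Proof.
move=> hi; rewrite (expand_det_col _ i) big1 // => j _.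
by rewrite mxE (negPf (hi j _)) ?mul0r // -ltnS.
Qed.

Lemma det_color_mx_inj d (x : nat -> T) (j k : 'I_d.+1) :
  \det (color_mx d x) != 0 -> c (x j) = c (x k) -> j = k.
Proof.
move=> nz ejk; apply/eqP; apply: contraR nz => njk; apply/eqP.
by apply: (determinant_alternate njk) => i; rewrite !mxE ejk.
Qed.

(* Each row of the colour matrix sums to 1, so the last row of [adj Y * Y = det Y]
   shows that the cofactors of the last column sum to [det Y]. *)
Lemma det_color_mxS d (x : nat -> T) :
  (forall j, (j <= d.+1)%N -> (c (x j) <= d.+1)%N) ->
  \det (color_mx d.+1 x) =
  \sum_(j < d.+2) \det (color_mx d (fun k => x (bump j k))).
Proof.
move=> hc; set Y := color_mx _ x.
have rowE (j : 'I_d.+2) : \sum_i Y j i = 1.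
  have hj : (c (x j) < d.+2)%N by rewrite ltnS hc // -ltnS.
  rewrite (bigD1 (Ordinal hj)) //= mxE eqxx big1 ?addr0 // => i.
  by rewrite mxE -val_eqE /= eq_sym => /negPf ->.
transitivity (\sum_i (\adj Y *m Y) ord_max i).
  rewrite mul_adj_mx (bigD1 ord_max) //= big1 ?addr0 => [|i /negPf ni].
    by rewrite mxE eqxx.
  by rewrite mxE eq_sym ni.
under eq_bigr do rewrite mxE.
rewrite exchange_big; apply: eq_bigr => j _ /=.
rewrite -mulr_sumr rowE mulr1 mxE /cofactor F2_signr mul1r.
congr (\det _); apply/matrixP => k i; rewrite !mxE /=.
by rewrite {2}/bump leqNgt ltn_ord add0n.
Qed.

End ColorMatrix.

(** * The Sperner-Kuhn lemma, by induction on the dimension of a face *)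

Section Kuhn.
Variables (D m : nat) (c : {ffun 'I_D -> nat} -> nat).
Hypothesis D_gt0 : (0 < D)%N.
Let inbox (x : {ffun 'I_D -> nat}) := forall i : 'I_D, (x i <= m.+1)%N.
Hypothesis c_le : forall x, inbox x -> (c x <= D)%N.
Hypothesis c_face0 : forall x (i : 'I_D), inbox x -> x i = 0%N -> (c x <= i)%N.
Hypothesis c_face1 : forall x (i : 'I_D), inbox x -> x i = m.+1 -> c x != i.

Implicit Types (p : {ffun 'I_D -> 'I_m.+1}) (s : 'S_D).

(* [s] gives the rank at which each coordinate is incremented. *)
Definition kuhn_vertex p s (j : nat) : {ffun 'I_D -> nat} :=
  [ffun i => (p i + (s i < j))%N].

Definition flat (d : nat) p := [forall i : 'I_D, (d <= i)%N ==> (p i == ord0)].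
Definition low (d : nat) : {set 'I_D} := [set i : 'I_D | (i < d)%N].

(** The number modulo 2 of fully coloured [d]-simplices in the face of the cube where the
    coordinates from [d] on vanish. *)
Definition kuhn_sum d : 'F_2 :=
  \sum_(p | flat d p) \sum_(s in Sym (low d))
    \det (color_mx c d (kuhn_vertex p s)).

Lemma kuhn_vertex_inbox p s j : inbox (kuhn_vertex p s j).
Proof. by move=> i; rewrite ffunE; have := ltn_ord (p i); lia. Qed.

Lemma Sym_low d s (i : 'I_D) : s \in Sym (low d) -> (d <= i)%N -> s i = i.
Proof.
by rewrite inE => hs di; apply: (out_perm hs); rewrite inE -leqNgt.
Qed.

Lemma kuhn_sum0 : kuhn_sum 0 = 1.
Proof.
have Fp p : flat 0 p = (p == [ffun=> ord0]).
  apply/forallP/eqP => [h|-> i]; last by rewrite ffunE eqxx.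
  by apply/ffunP => i; rewrite ffunE; apply/eqP; have := h i.
rewrite /kuhn_sum (eq_bigl _ _ Fp) big_pred1_eq.
have Fs s : (s \in Sym (low 0)) = (s == 1%g).
  apply/idP/eqP => [h|->]; last exact: group1.
  by apply/permP => i; rewrite (Sym_low h) // perm1.
rewrite (eq_bigl _ _ Fs) big_pred1_eq det_mx11 mxE.
suff -> : c (kuhn_vertex [ffun=> ord0] 1 0) == 0%N by [].
rewrite -leqn0; apply: (c_face0 (i := Ordinal D_gt0)).
  exact: kuhn_vertex_inbox.
by rewrite !ffunE.
Qed.

Section Step.
Variable d : nat.
Hypothesis dD : (d < D)%N.
Let od : 'I_D := Ordinal dD.

(** If [d.+1 < D], coordinate [d.+1] of the vertex is zero and [c_face0] applies; otherwise
    [d.+1 = D] and [c_le] is enough. *)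
Lemma kuhn_vertex_color p s j : flat d.+1 p -> s \in Sym (low d.+1) ->
  (j <= d.+1)%N -> (c (kuhn_vertex p s j) <= d.+1)%N.
Proof.
move=> /forallP fp hs jd; have [dD'|Dd] := ltnP d.+1 D; last first.
  by apply: leq_trans Dd; apply/c_le/kuhn_vertex_inbox.
apply: (c_face0 (i := Ordinal dD')); first exact: kuhn_vertex_inbox.
rewrite ffunE (Sym_low hs) //=; have := fp (Ordinal dD').
by rewrite leqnn => /eqP -> /=; lia.
Qed.

(* Exchanging the ranks [j] and [j.+1] only moves vertex [j.+1], so the simplices
   cancel in pairs sharing the facet opposite to that vertex. *)
Lemma inner_facets p (j : nat) : (j < d)%N ->
  \sum_(s in Sym (low d.+1))
    \det (color_mx c d (fun k => kuhn_vertex p s (bump j.+1 k))) = 0.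
Proof.
move=> jd; have j0D : (j < D)%N by lia.
have j1D : (j.+1 < D)%N by lia.
pose a := Ordinal j0D; pose b := Ordinal j1D.
have nab : a != b by rewrite -val_eqE /= neq_ltn ltnSn.
have tS : tperm a b \in Sym (low d.+1).
  rewrite inE; apply/fintype.subsetP => i; rewrite !inE.
  by case: tpermP => [->|->|]; rewrite ?eqxx //= => _; lia.
(* The transposition exchanges odd and even permutations; paired terms are equal and cancel in
   characteristic 2. *)
rewrite (bigID (fun s : 'S_D => odd_perm s)) /=.
rewrite (reindex_inj (mulIg (tperm a b))) /=.
under eq_bigl => s do
  rewrite groupMr // odd_permM odd_tperm nab addbT.
rewrite -big_split /= big1 // => s _.
rewrite (@eq_color_mx _ _ _ _ (fun k => kuhn_vertex p s (bump j.+1 k))).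
  exact: F2_addrr.
move=> k kd; apply/ffunP => i; rewrite !ffunE permM; congr (_ + nat_of_bool _)%N.
by rewrite /bump; case: tpermP => [->|->|] //=; lia.
Qed.

(** The cycle [0 -> 1 -> ... -> d -> 0] of ranks: under [s * rot] the coordinate of [s]-rank [d] is
    incremented first and the others follow in the order of [s]. *)
Definition rot_fun (t : 'I_D) : 'I_D :=
  if (t < d)%N then insubd od t.+1
  else if t == od then insubd od 0%N else t.

Lemma rot_funE t : rot_fun t =
  (if (t < d)%N then t.+1 else if t == d :> nat then 0 else t)%N :> nat.
Proof.
rewrite /rot_fun -val_eqE /=; case: ifP => td; last case: ifP => // _.
  by rewrite val_insubd (leq_ltn_trans td dD).
by rewrite val_insubd D_gt0.
Qed.

Lemma rot_fun_inj : injective rot_fun.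
Proof.
move=> t u /(congr1 val) /=; rewrite !rot_funE => e; apply: val_inj => /=.
by move: e; case: (ltngtP t d) => ?; case: (ltngtP u d) => ?; lia.
Qed.

Definition rot : 'S_D := perm rot_fun_inj.

Lemma rot_Sym : rot \in Sym (low d.+1).
Proof.
rewrite inE; apply/fintype.subsetP => i; rewrite !inE permE -val_eqE /= rot_funE.
by do ![case: ifP => ?]; lia.
Qed.

(** One step in direction [i0], taken cyclically so that it can reindex a sum over all [p]; wrapping
    occurs exactly when [p i0 = m]. *)
Definition shift (i0 : 'I_D) p : {ffun 'I_D -> 'I_m.+1} :=
  [ffun i => if i == i0 then ordS (p i) else p i].

Lemma shift_inj i0 : injective (shift i0).
Proof.
move=> p q /ffunP e; apply/ffunP => i; have := e i; rewrite !ffunE.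
by case: ifP => // _ /(can_inj (@ordSK _)).
Qed.

Lemma flat_shift (i0 : 'I_D) p : (i0 <= d)%N -> flat d.+1 (shift i0 p) = flat d.+1 p.
Proof.
move=> i0d; apply: eq_forallb => i; rewrite ffunE.
by case: (eqVneq i i0) => // ->; rewrite ltnNge i0d.
Qed.

Lemma ordS_eq0 (t : 'I_m.+1) : (ordS t == ord0) = (t == ord_max).
Proof.
rewrite -!val_eqE /=; have := ltn_ord t; rewrite ltnS leq_eqVlt => /orP[/eqP ->|tm].
  by rewrite modnn !eqxx.
by rewrite modn_small // (ltn_eqF tm).
Qed.

(* The facet opposite to the first vertex is the facet opposite to the last vertex of
   the next simplex in the direction of that facet, or lies on the face [m.+1]. *)
Lemma first_facets s : s \in Sym (low d.+1) ->
  \sum_(p | flat d.+1 p)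
     \det (color_mx c d (fun k => kuhn_vertex p (s * rot)%g k.+1)) =
  \sum_(p | flat d.+1 p && (p ((s^-1)%g od) != ord0))
     \det (color_mx c d (kuhn_vertex p s)).
Proof.
move=> hs; set i0 := (s^-1)%g od.
have si0 : s i0 = od by rewrite permKV.
have i0d : (i0 <= d)%N.
  rewrite leqNgt; apply/negP => di0.
  by have := Sym_low hs di0; rewrite si0 => e; rewrite -e /= ltnn in di0.
have srot i k : (k <= d)%N ->
    ((s * rot)%g i < k.+1)%N = ((s i < k) + (i == i0) :> nat)%N :> nat.
  move=> kd; rewrite permM permE rot_funE.
  have -> : (i == i0) = (s i == d :> nat).
    by rewrite -(inj_eq (@perm_inj _ s)) si0 -val_eqE.
  by do ![case: ifP => ?]; lia.
rewrite [RHS](reindex_inj (@shift_inj i0)) /=.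
under [RHS]eq_bigl => p do rewrite flat_shift // ffunE eqxx ordS_eq0.
rewrite (bigID (fun p : {ffun 'I_D -> 'I_m.+1} => p i0 == ord_max)) /=.
rewrite big1 ?add0r => [|p /andP[_ /eqP pm]].
  apply: eq_bigr => p /andP[_ pm]; congr (\det _); apply: eq_color_mx => k kd.
  apply/ffunP => i; rewrite !ffunE srot //.
  case: eqP => [->|_]; last by rewrite addn0.
  rewrite addnA addn1 /= modn_small ?addSn //.
  rewrite ltnS ltn_neqAle -ltnS ltn_ord andbT.
  exact: pm.
have i0d' : (i0 < d.+1)%N by [].
(* Here [p i0 = m], and [i0] is incremented first: every vertex of the facet has coordinate [i0]
   equal to [m.+1], so colour [i0] is missing. *)
apply: (det_color_mx_missing (i := Ordinal i0d')) => k kd.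
apply: c_face1; first exact: kuhn_vertex_inbox.
rewrite ffunE srot // eqxx pm si0 /=; lia.
Qed.

(** Expand each [d.+1]-simplex into facets. Inner facets cancel, and first facets cancel the last
    facets with a nonzero base coordinate in direction [s^-1 od]. The last facets left over lie on a
    face where that coordinate is zero; the direction [od] gives the [d]-simplices of
    [kuhn_sum d]. *)
Lemma kuhn_sumS : kuhn_sum d.+1 = kuhn_sum d.
Proof.
transitivity (\sum_(s in Sym (low d.+1))
    \sum_(p | flat d.+1 p && (p ((s^-1)%g od) == ord0))
      \det (color_mx c d (kuhn_vertex p s))).
  transitivity (\sum_(j < d.+2) \sum_(p | flat d.+1 p) \sum_(s in Sym (low d.+1))
      \det (color_mx c d (fun k => kuhn_vertex p s (bump j k)))).
    rewrite [RHS]exchange_big; apply: eq_bigr => p fp.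
    rewrite [RHS]exchange_big; apply: eq_bigr => s hs.
    by apply: det_color_mxS => j jd; apply: kuhn_vertex_color.
  rewrite big_ord_recl big_ord_recr /= [X in _ + (X + _)]big1 ?add0r => [|j _]; last first.
    by apply: big1 => p _; apply: (inner_facets _ (ltn_ord j)).
  rewrite exchange_big (reindex_inj (mulIg rot)) /=.
  under eq_bigl => s do rewrite groupMr ?rot_Sym //.
  rewrite (exchange_big _ _ _ _ _ (fun p s => \det _)) -big_split /=.
  apply: eq_bigr => s hs.
  rewrite [X in X + _](_ : _ = \sum_(p | flat d.+1 p && (p ((s^-1)%g od) != ord0))
     \det (color_mx c d (kuhn_vertex p s))); last exact: first_facets.
  rewrite [X in _ + X](_ : _ = \sum_(p | flat d.+1 p)
     \det (color_mx c d (kuhn_vertex p s))); last first.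
    apply: eq_bigr => p _; congr (\det _); apply: eq_color_mx => k kd.
    by rewrite /bump /= ltnNge kd.
  rewrite [X in _ + X](bigID (fun p : {ffun 'I_D -> 'I_m.+1} =>
     p ((s^-1)%g od) == ord0)) /=.
  by rewrite addrCA F2_addrr addr0.
rewrite /kuhn_sum exchange_big /=.
rewrite (bigID (fun s : 'S_D => s od == od)) /= addrC big1 ?add0r.
  apply: eq_big => [s|s /andP[hs /eqP sd]].
    apply/andP/idP => [[hs /eqP sd]|hs].
      rewrite inE; apply/fintype.subsetP => i; rewrite !inE => si.
      rewrite ltnNge; apply/negP; rewrite leq_eqVlt => /orP[/eqP di|di].
        by move: si; rewrite (_ : i = od) ?sd ?eqxx //; apply: val_inj.
      by move: si; rewrite (Sym_low hs di) eqxx.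
    split; last by rewrite (Sym_low hs).
    move: hs; rewrite !inE => /fintype.subsetP hs; apply/fintype.subsetP => i /hs.
    by rewrite !inE => /ltnW.
  have -> : (s^-1)%g od = od by rewrite -{1}sd permK.
  apply: eq_bigl => p; apply/andP/forallP => [[/forallP h /eqP pd] i|h].
    apply/implyP; rewrite leq_eqVlt => /orP[/eqP di|di].
      by rewrite (_ : i = od) ?pd //; apply: val_inj.
    exact: (implyP (h i)).
  split; last by have := h od; rewrite leqnn.
  by apply/forallP => i; apply/implyP => di; apply: (implyP (h i)); apply: ltnW.
(* For a direction [i0 < d], coordinate [i0] vanishes on the whole facet, so its colours are at most
   [i0] and colour [d] is missing. *)
move=> s /andP[hs sd]; apply: big1 => p /andP[fp /eqP p0].
set i0 := (s^-1)%g od in p0.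
have si0 : s i0 = od by rewrite permKV.
have ni0 : i0 != od by apply: contraNneq sd => e; rewrite -{1}e si0.
have i0d : (i0 < d)%N.
  rewrite ltnNge; apply/negP; rewrite leq_eqVlt => /orP[/eqP e|di0].
    by move/eqP: ni0; apply; apply: val_inj.
  by have := Sym_low hs di0; rewrite si0 => e; rewrite -e /= ltnn in di0.
apply: (det_color_mx_missing (i := ord_max)) => k kd; apply: contraTneq i0d => /= ck.
rewrite -leqNgt -{1}ck; apply: c_face0; first exact: kuhn_vertex_inbox.
rewrite ffunE p0 si0 /=; lia.
Qed.

End Step.

Lemma kuhn_sum1 d : (d <= D)%N -> kuhn_sum d = 1.
Proof. by elim: d => [_|d IH dD]; rewrite ?kuhn_sum0 // kuhn_sumS ?IH // ltnW. Qed.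

(** The sum for [d = D] is nonzero, hence so is one of its determinants, and a nonzero determinant
    has no two equal rows. *)
Lemma kuhn : exists (p : {ffun 'I_D -> nat}) (x : 'I_D.+1 -> {ffun 'I_D -> nat}),
  (forall j i, [/\ (p i <= x j i)%N, (x j i <= (p i).+1)%N & (p i < m.+1)%N]) /\
  injective (c \o x).
Proof.
suff [p [s nz]] : exists p s, \det (color_mx c D (kuhn_vertex p s)) != 0.
  exists [ffun i => p i : nat], (fun j => kuhn_vertex p s j); split.
    move=> j i; rewrite !ffunE; have := ltn_ord (p i).
    by move: (s i < j)%N => b pm; split; lia.
  by move=> j k; apply: det_color_mx_inj nz.
apply: contrapT => h; have := kuhn_sum1 (leqnn D).
rewrite /kuhn_sum big1 => [/esym/eqP|p _]; first by rewrite oner_eq0.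
apply: big1 => s _; apply/eqP/negPn/negP => nz.
by apply: h; exists p, s.
Qed.

End Kuhn.

(** * Elementary estimates for products and sums *)

Lemma prod_dist_le (R : realDomainType) (I : Type) (r : seq I) (a b : I -> R) :
  (forall i, 0 <= a i <= 1) -> (forall i, 0 <= b i <= 1) ->
  `|\prod_(i <- r) a i - \prod_(i <- r) b i| <= \sum_(i <- r) `|a i - b i|.
Proof.
move=> ha hb; elim: r => [|i r IH]; first by rewrite !big_nil subrr normr0.
rewrite !big_cons; set p := \prod_(j <- r) a j; set q := \prod_(j <- r) b j.
have /andP[p0 p1] : 0 <= p <= 1.
  by apply/andP; split; [apply: prodr_ge0 => j _; case/andP: (ha j) | apply: prodr_ile1 => j _].
(* Change one factor at a time; the factors kept lie in [0, 1]. *)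
have -> : a i * p - b i * q = (a i - b i) * p + b i * (p - q) by ring.
apply: le_trans (ler_normD _ _) _; rewrite !normrM.
have /andP[b0 b1] := hb i.
rewrite (ger0_norm p0) (ger0_norm b0) lerD ?ler_piMr //.
by apply: le_trans IH; rewrite ler_piMl.
Qed.

(** Pigeonhole principle; lists shorter than [k] are covered because [a] is positive. *)
Lemma sum_ge_ex (R : realDomainType) (T : eqType) (s : seq T) (f : T -> R) (a : R)
    (k : nat) :
  (size s <= k)%N -> (0 < k)%N -> 0 < a -> a *+ k <= \sum_(v <- s) f v ->
  exists2 v, v \in s & a <= f v.
Proof.
move=> sk k0 a0 hs; apply: contrapT => h.
have lt v : v \in s -> f v < a.
  by move=> vs; rewrite ltNge; apply/negP => av; apply: h; exists v.
have {h} [s0|s0] := eqVneq s [::].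
  by move: hs; rewrite s0 big_nil leNgt pmulrn_lgt0 // a0.
suff : \sum_(v <- s) f v < a *+ k by rewrite ltNge hs.
apply: (@lt_le_trans _ _ (\sum_(v <- s) a)).
  rewrite big_seq [ltRHS]big_seq; apply: ltr_sum => //.
  by case: s s0 {sk hs lt} => // v s _; apply/hasP; exists v; rewrite inE eqxx.
rewrite big_const_seq count_predT iter_addr_0.
by rewrite ler_wpMn2l // ltW.
Qed.

(** * Probabilities of single outputs and their dependence on the bias *)

Section OutputMass.
Variables (R : realType) (d : nat) (A : coin_algorithm R d) (eps delta : R) (n : nat).
Implicit Types (x : 'M[bool]_(d, n)) (b v : 'rV[R]_d) (L : set 'rV[R]_d).

Lemma toss_pmf_dist x b b' (h : R) : bias_vector b -> bias_vector b' ->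
  (forall i, `|b 0 i - b' 0 i| <= h) ->
  `|toss_pmf b x - toss_pmf b' x| <= h *+ (d * n).
Proof.
move=> hb hb' hh.
have pmf01 (c : 'rV[R]_d) : bias_vector c -> forall i j, 0 <= bernoulli_pmf (c 0 i) (x i j) <= 1.
  by move=> hc i j; have := hc i; rewrite /bernoulli_pmf; case: ifP => _; lra.
apply: le_trans (prod_dist_le _ _ _) _.
- move=> i; apply/andP; split; last by apply: prodr_ile1 => j _; apply: pmf01.
  by apply: prodr_ge0 => j _; case/andP: (pmf01 _ hb i j).
- move=> i; apply/andP; split; last by apply: prodr_ile1 => j _; apply: pmf01.
  by apply: prodr_ge0 => j _; case/andP: (pmf01 _ hb' i j).
apply: (@le_trans _ _ (\sum_(i < d) h *+ n)); last first.
  by rewrite sumr_const card_ord -mulrnA mulnC.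
apply: ler_sum => i _; apply: le_trans (prod_dist_le _ (pmf01 _ hb i) (pmf01 _ hb' i)) _.
apply: (@le_trans _ _ (\sum_(j < n) h)); last by rewrite sumr_const card_ord.
apply: ler_sum => j _; apply: le_trans (hh i); rewrite /bernoulli_pmf.
case: ifP => // _; rewrite distrC.
by have -> : 1 - b' 0 i - (1 - b 0 i) = b 0 i - b' 0 i by ring.
Qed.

(** The fibre over [v] is a finite intersection of coordinate fibres. *)
Lemma measurable_run_eq x v : measurable (run A eps delta x @^-1` [set v]).
Proof.
have -> : run A eps delta x @^-1` [set v] =
    \bigcap_(i in [set: 'I_d]) ((fun w => run A eps delta x w 0 i) @^-1` [set v 0 i]).
  apply/seteqP; split=> [w /= rv i _ /=|w h]; first by rewrite rv.
  apply/rowP => i; exact: h.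
apply: fin_bigcap_measurable => // i _; rewrite -[X in measurable X]setTI.
exact: run_measurable.
Qed.

Lemma run_preimageE x L : run A eps delta x @^-1` L =
  \bigcup_(v in L) (run A eps delta x @^-1` [set v]).
Proof.
by apply/seteqP; split=> [w Lw|w [v Lv /= ->]] //; exists (run A eps delta x w).
Qed.

Definition seed_mass x v : R := fine (seed_law A (run A eps delta x @^-1` [set v])).

Definition output_mass b v : R := \sum_x toss_pmf b x * seed_mass x v.

(** A finite list pulls back to a finite disjoint union of measurable fibres. *)
Lemma seed_lawE x L : finite_set L ->
  seed_law A (run A eps delta x @^-1` L) =
  (\sum_(v <- fset_set L) seed_mass x v)%:E.
Proof.
move=> fL; rewrite run_preimageE measure_fin_bigcup //; last by move=> v _; apply: measurable_run_eq.
  rewrite fsbig_finite //= -sumEFin; apply: eq_bigr => v _.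
  by rewrite fineK // fin_num_measure //; apply: measurable_run_eq.
by move=> v v' _ _ [w [/= -> ->]].
Qed.

Lemma seed_mass_ge0 x v : 0 <= seed_mass x v.
Proof. exact: fine_ge0. Qed.

Lemma measurable_run x L : finite_set L -> measurable (run A eps delta x @^-1` L).
Proof.
move=> fL; rewrite run_preimageE.
by apply: fin_bigcup_measurable => // v _; apply: measurable_run_eq.
Qed.

Lemma sum_seed_mass_le1 x (F : {fset 'rV[R]_d}) : \sum_(v <- F) seed_mass x v <= 1.
Proof.
rewrite -lee_fin -[F]set_fsetK -seed_lawE //.
by apply: probability_le1; apply: measurable_run.
Qed.

Lemma seed_mass_le1 x v : seed_mass x v <= 1.
Proof. by have := sum_seed_mass_le1 x [fset v]%fset; rewrite big_seq_fset1. Qed.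

Lemma output_probE b L : finite_set L ->
  output_prob A eps delta n b L = (\sum_(v <- fset_set L) output_mass b v)%:E.
Proof.
move=> fL; rewrite /output_prob exchange_big /= -sumEFin; apply: eq_bigr => x _.
by rewrite seed_lawE // -EFinM mulr_sumr.
Qed.

Lemma sum_output_mass_le1 b (F : {fset 'rV[R]_d}) : bias_vector b ->
  \sum_(v <- F) output_mass b v <= 1.
Proof.
move=> hb; rewrite exchange_big /= -(toss_pmf_sum1 n b); apply: ler_sum => x _.
by rewrite -mulr_sumr ler_piMr ?toss_pmf_ge0 ?sum_seed_mass_le1.
Qed.

(** Only the toss weights depend on the bias; the seed masses are common to [b] and [b'] and at most
    1, so the bound is uniform in [v]. *)
Lemma output_mass_dist b b' v (h : R) : bias_vector b -> bias_vector b' ->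
  (forall i, `|b 0 i - b' 0 i| <= h) ->
  `|output_mass b v - output_mass b' v| <= h *+ (d * n) *+ #|{: 'M[bool]_(d, n)}|.
Proof.
move=> hb hb' hh; rewrite /output_mass -sumrB.
apply: le_trans (ler_norm_sum _ _ _) _; rewrite -sumr_const; apply: ler_sum => x _.
rewrite -mulrBl normrM (ger0_norm (seed_mass_ge0 _ _)).
apply: le_trans (toss_pmf_dist x hb hb' hh).
by rewrite ler_piMr ?seed_mass_le1.
Qed.

Lemma heavy_output b L (k : nat) : (0 < k)%N -> delta < 1 -> (L #<= `I_k)%card ->
  ((1 - delta)%:E <= output_prob A eps delta n b L)%E ->
  exists2 v, L v & (1 - delta) / k%:R <= output_mass b v.
Proof.
move=> k0 d1 Lk; have fL : finite_set L by apply/finite_set_leP; exists k.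
rewrite output_probE // lee_fin => hL.
have [||||v] := @sum_ge_ex _ _ (fset_set L) (output_mass b) ((1 - delta) / k%:R) k.
- exact: geq_card_fset_set.
- by [].
- by rewrite divr_gt0 ?subr_gt0 ?ltr0n.
- by rewrite -[X in X <= _]mulr_natr divfK // pnatr_eq0 -lt0n.
by rewrite in_fset_set // in_setE; exists v.
Qed.

End OutputMass.

(** * Nearby biases with pairwise distinct labels *)

Section SeparatedLabels.
Variables (R : realType) (d : nat).

Definition grid_point (N : nat) (x : {ffun 'I_d -> nat}) : 'rV[R]_d :=
  \row_i ((x i)%:R / N%:R).

Lemma grid_point_bias N (x : {ffun 'I_d -> nat}) : (0 < N)%N ->
  (forall i, (x i <= N)%N) -> bias_vector (grid_point N x).
Proof.
move=> N0 xN i; rewrite mxE divr_ge0 //= ler_pdivrMr ?ltr0n // mul1r ler_nat.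
exact: xN.
Qed.

(* A set of points with a common label lies in a box of side 1/2, so it cannot meet two
   opposite faces of the cube: colour a label by its first coordinate below 1/2. *)
Lemma distinct_labels (f : 'rV[R]_d -> 'rV[R]_d) (m : nat) : (0 < d)%N ->
  (forall b, bias_vector b -> closed_box b 4^-1 (f b)) ->
  exists b : 'I_d.+1 -> 'rV[R]_d,
    [/\ forall j, bias_vector (b j),
        forall j k i, `|b j 0 i - b k 0 i| <= m.+1%:R^-1
      & injective (f \o b)].
Proof.
move=> d0 hf; pose g := grid_point m.+1.
(* [find] returns [d] when no coordinate is below 1/2, which supplies the last of the [d.+1]
   colours. *)
pose hd (v : 'rV[R]_d) : nat := find (fun i => v 0 i < 2^-1) (enum 'I_d).
have nthi (i j : 'I_d) : nth j (enum 'I_d) i = i by rewrite nth_ord_enum.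
have gb (x : {ffun 'I_d -> nat}) : (forall i : 'I_d, (x i <= m.+1)%N) -> bias_vector (g x).
  exact: grid_point_bias.
have [|x i xN x0|x i xN x1|p [x [px xinj]]] := @kuhn d m (fun x => hd (f (g x))) d0.
- by move=> x _; rewrite /hd (leq_trans (find_size _ _)) // size_enum_ord.
(* On the face [x i = 0] coordinate [i] of the label is at most 1/4, so the search stops at [i] or
   earlier. *)
- rewrite leqNgt; apply/negP => /(before_find i); rewrite nthi => /negP; apply.
  by have := hf _ (gb _ xN) i; rewrite !mxE x0 mul0r; lra.
(* On the face [x i = m.+1] coordinate [i] of the label is at least 3/4, so the search does not stop
   at [i]. *)
- apply/eqP => e; have := hf _ (gb _ xN) i; rewrite !mxE x1 divff ?pnatr_eq0 //.
  have : has (fun j => f (g x) 0 j < 2^-1) (enum 'I_d).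
    by rewrite has_find [X in (X < _)%N]e size_enum_ord.
  by move/(nth_find i); rewrite [X in nth _ _ X]e nthi; lra.
exists (g \o x); split=> [j|j k i|j k /= e].
- by apply: gb => i; have [_ h1 h2] := px j i; apply: leq_trans h1 h2.
- rewrite !mxE -mulrBl normrM [X in _ * X]ger0_norm ?invr_ge0 //.
  rewrite ler_piMl ?invr_ge0 //.
  have [a1 a2 _] := px j i; have [b1 b2 _] := px k i.
  have : ((x j i)%:R <= (x k i)%:R + 1 :> R) by rewrite natr1 ler_nat; lia.
  have : ((x k i)%:R <= (x j i)%:R + 1 :> R) by rewrite natr1 ler_nat; lia.
  by rewrite ler_norml; lra.
by apply: xinj; rewrite /= e.
Qed.

End SeparatedLabels.

(** * Too much output mass at a single bias *)

Theorem theorem4p7 (R : realType) (d k : nat) (hd : (1 <= d)%N)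
    (hk : (0 < k)%N) (hkd : (k < d + 1)%N) :
  ~ exists A : coin_algorithm R d, list_replicable k A.
Proof.
move=> [A hA]; pose D : R := d%:R.
have D1 : 1 <= D by rewrite ler1n.
(* With this [delta], [d + 1] masses of [(1 - delta) / d] add up to [1 + 1 / (2 d)]. *)
pose eps : R := 4^-1; pose delta : R := (2 * (D + 1))^-1.
have eps0 : 0 < eps by rewrite invr_gt0.
have delta0 : 0 < delta by rewrite invr_gt0; lra.
have delta1 : delta < 1 by rewrite invf_lt1; lra.
have [|n hn] := hA eps delta eps0; first by rewrite delta0 ltW.
have /boolp.choice[f hf] : forall b : 'rV[R]_d, exists v : 'rV[R]_d, bias_vector b ->
    closed_box b eps v /\ (1 - delta) / k%:R <= output_mass A eps delta n b v.
  move=> b; have [hb|hb] := pselect (bias_vector b); last by exists 0.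
  have [L [Lb Lk Lp]] := hn b hb.
  by have [v Lv hv] := heavy_output hk delta1 Lk Lp; exists v => _; split => //; apply: Lb.
(* [C] is the Lipschitz constant of [output_mass_dist]. An error [eta] in each of [d + 1] masses
   costs [1 / (4 d)], half of the excess over 1, and [m] makes the grid fine enough for that
   error. *)
pose C : R := ((d * n) * #|{: 'M[bool]_(d, n)}|)%:R.
pose eta : R := (4 * D * (D + 1))^-1.
have eta0 : 0 < eta by rewrite invr_gt0 !mulr_gt0; lra.
pose m := Num.bound (C / eta).
have Cm : C / m.+1%:R <= eta.
  rewrite ler_pdivrMr ?ltr0n // mulrC -ler_pdivrMr //.
  have := archi_boundP (divr_ge0 (ler0n _ _) (ltW eta0) : 0 <= C / eta).
  by move/ltW/le_trans; apply; rewrite ler_nat.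
have [b [hb bb finj]] := distinct_labels m hd (fun b hb => (hf b hb).1).
(* Transport the mass of each label from its own grid point to the common bias [b ord0]. *)
have mass j : (1 - delta) / D - eta <= output_mass A eps delta n (b ord0) (f (b j)).
  have h1 := (hf _ (hb j)).2.
  have := output_mass_dist A eps delta n (f (b j)) (hb j) (hb ord0) (bb j ord0).
  rewrite -mulrnA -[X in _ <= X]mulr_natr mulrC => /le_trans/(_ Cm) h2.
  have h3 : (1 - delta) / D <= (1 - delta) / k%:R.
    rewrite ler_wpM2l ?subr_ge0 ?(ltW delta1) // lef_pV2 ?posrE ?ltr0n //.
    by rewrite ler_nat; lia.
  by move: h2; rewrite ler_norml; lra.
have := sum_output_mass_le1 A eps delta n [fset f (b j) | j in 'I_d.+1]%fset (hb ord0).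
rewrite big_imfset /=; last by move=> j l _ _; apply: finj.
rewrite big_enum /=; apply/negP; rewrite -ltNge.
apply: (@lt_le_trans _ _ (\sum_(j < d.+1) ((1 - delta) / D - eta))); last exact: ler_sum.
rewrite sumr_const card_ord -mulr_natr -natr1 -/D.
have -> : ((1 - delta) / D - eta) * (D + 1) = 1 + (4 * D)^-1.
  by rewrite /delta /eta; field; apply/andP; split; lra.
by rewrite ltrDl invr_gt0; lra.
Qed.
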